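(* Let $k \geq 2$ and $p_1 \geq p_2 \geq \cdots \geq p_k \geq 1$ be integers, $n = p_1 + \cdots + p_k$, let $G = K_{p_1,\ldots,p_k}$ be the complete multipartite graph with parts $V_i = \{x_{ij} : 1 \leq j \leq p_i\}$, $1 \leq i \leq k$, and let $J(G) \subset S = \mathbb{K}[x_{ij} : 1 \leq i \leq k,\ 1 \leq j \leq p_i]$ be its cover ideal, where $\mathbb{K}$ is a field. If $s = 2r$ with $r \geq 1$, then $$H\left(\frac{S}{J(G)^{(s)}},t\right) = \frac{1 - t^{rn} + \sum_{j=0}^{r-1}\sum_{i=1}^{k}(t^{p_i}-1)\,t^{(s-j)(n-p_i)+jp_i}}{(1-t)^n},$$ and if $s = 2r+1$ with $r \geq 0$, then $$H\left(\frac{S}{J(G)^{(s)}},t\right) = \frac{1 + (k-1)t^{(r+1)n} - \sum_{i=1}^{k} t^{(n-p_i)+rn} + \sum_{j=0}^{r-1}\sum_{i=1}^{k}(t^{p_i}-1)\,t^{(s-j)(n-p_i)+jp_i}}{(1-t)^n}.$$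
   Context: The complete multipartite graph $K_{p_1,\ldots,p_k}$ has vertex set the disjoint union $V_1 \cup \cdots \cup V_k$ with $|V_i| = p_i$, and its edges are all pairs $\{x,y\}$ with $x \in V_i$, $y \in V_j$, $i \neq j$. Vertices of a graph are identified with the variables of the standard graded polynomial ring $S$. The cover ideal of a graph $G$ is $J(G) = \left(\prod_{x \in w} x \mid w \text{ a minimal vertex cover of } G\right) \subset S$; equivalently $J(G) = \bigcap_{\{u,v\} \in E(G)} (u,v)$. The $s$-th symbolic power of an ideal $I$ is $I^{(s)} = \bigcap_{\mathfrak{p} \in \operatorname{Ass}(S/I)} (I^s S_{\mathfrak{p}} \cap S)$; for a squarefree monomial ideal, $I^{(s)} = \bigcap_{\mathfrak{p} \in \operatorname{Ass}(S/I)} \mathfrak{p}^s$. For a finitely generated graded $S$-module $N = \bigoplus_{d \in \mathbb{N}} N_d$, the Hilbert series is $H(N,t) = \sum_{d \in \mathbb{N}} \dim_{\mathbb{K}}(N_d)\,t^d$. Empty sums are $0$. *)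

(* Defs.v *)
From HB Require Import structures.
From mathcomp Require Import all_boot all_order all_algebra.
From mathcomp Require Import mpoly.
From Stdlib Require Import ClassicalEpsilon.

Set Implicit Arguments.
Unset Strict Implicit.
Unset Printing Implicit Defensive.

Import GRing.Theory.

Local Open Scope ring_scope.

(* Membership in the ideals below is not decidable in general, so ideals are
   Prop-valued predicates rather than instances of the boolean [ideal] classes
   of ring_quotient (which moreover only cover proper ideals). *)
Section Ideals.
Variable R : comNzRingType.
Implicit Types (A I P : R -> Prop) (f g : R).

Definition is_ideal I : Prop :=
  [/\ I 0, (forall f g, I f -> I g -> I (f + g))
    & forall f g, I g -> I (f * g)].

Definition ideal_gen A : R -> Prop := fun f =>
  exists m (a g : 'I_m -> R), (forall i, A (g i)) /\ f = \sum_i a i * g i.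

Definition ideal_exp I (s : nat) : R -> Prop :=
  ideal_gen (fun f => exists g : 'I_s -> R,
    (forall i, I (g i)) /\ f = \prod_i g i).

Definition prime_ideal P : Prop :=
  [/\ is_ideal P, ~ P 1 & forall f g, P (f * g) -> P f \/ P g].

(* P \in Ass(R/I): P is prime and is the annihilator of the class of some f *)
Definition associated_prime I P : Prop :=
  prime_ideal P /\ exists f, forall g, P g <-> I (g * f).

(* I R_P \cap R, the preimage of I R_P under R -> R_P: the image f/1 lies in
   I R_P iff some denominator g outside P satisfies g * f \in I. *)
Definition loc_contraction I P : R -> Prop := fun f =>
  exists2 g, ~ P g & I (g * f).

Definition symbolic_power I (s : nat) : R -> Prop := fun f =>
  forall P, associated_prime I P -> loc_contraction (ideal_exp I s) P f.

End Ideals.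

Section QuotientDimension.
Variables (K : fieldType) (V : lmodType K).
Implicit Types (W U : V -> Prop).

(* the classes of b_0, ..., b_(m-1) form a K-basis of W / (W \cap U) *)
Definition quot_basis W U m (b : 'I_m -> V) : Prop :=
  [/\ forall i, W (b i),
      (forall v, W v -> exists c : 'I_m -> K, U (v - \sum_i c i *: b i))
    & (forall c : 'I_m -> K, U (\sum_i c i *: b i) -> forall i, c i = 0)].

(* dim_K (W / (W \cap U)); arbitrary if that dimension is infinite *)
Definition quot_dim W U : nat :=
  epsilon (inhabits 0%N) (fun m => exists b : 'I_m -> V, quot_basis W U b).

Definition is_subspace U : Prop :=
  U 0 /\ forall a u v, U u -> U v -> U (a *: u + v).

Section Subspace.
Variable U : V -> Prop.
Hypothesis hU : is_subspace U.

Let U0 : U 0. Proof. by case: hU. Qed.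
Let UZ a u : U u -> U (a *: u).
Proof. by case: hU => _ h /(h a _ 0) /(_ U0); rewrite addr0. Qed.
Let UD u v : U u -> U v -> U (u + v).
Proof. by case: hU => _ h /(h 1 u v); rewrite scale1r. Qed.
Let UB u v : U u -> U v -> U (u - v).
Proof. by move=> hu hv; rewrite -scaleN1r; apply: UD => //; apply: UZ. Qed.
Let Usum m (F : 'I_m -> V) : (forall i, U (F i)) -> U (\sum_i F i).
Proof. by move=> h; apply: (big_ind U). Qed.

Lemma quot_basis_le W m1 m2 (b1 : 'I_m1 -> V) (b2 : 'I_m2 -> V) :
  quot_basis W U b1 -> quot_basis W U b2 -> (m1 <= m2)%N.
Proof.
case=> W1 S1 F1 [W2 S2 F2].
have exA i : exists c : 'I_m2 -> K, U (b1 i - \sum_j c j *: b2 j).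
  exact: S2.
have exB j : exists c : 'I_m1 -> K, U (b2 j - \sum_i c i *: b1 i).
  exact: S1.
pose a i := proj1_sig (constructive_indefinite_description _ (exA i)).
have ha i : U (b1 i - \sum_j a i j *: b2 j).
  exact: proj2_sig (constructive_indefinite_description _ (exA i)).
pose e j := proj1_sig (constructive_indefinite_description _ (exB j)).
have he j : U (b2 j - \sum_i e j i *: b1 i).
  exact: proj2_sig (constructive_indefinite_description _ (exB j)).
pose A := \matrix_(i < m1, j < m2) a i j.
pose B := \matrix_(j < m2, i < m1) e j i.
apply: (@mulmx1_min _ _ _ A B); apply/matrixP => i l; rewrite !mxE.
apply/eqP; rewrite -subr_eq0; apply/eqP.
under eq_bigr do rewrite !mxE.
apply: (F1 (fun l => \sum_j a i j * e j l - (i == l)%:R)).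
have -> : \sum_l (\sum_j a i j * e j l - (i == l)%:R) *: b1 l
    = (\sum_j a i j *: \sum_l e j l *: b1 l) - b1 i.
  under eq_bigr do rewrite scalerBl scaler_suml.
  rewrite sumrB exchange_big /=; congr (_ - _).
    apply: eq_bigr => j _; rewrite scaler_sumr.
    by apply: eq_bigr => l' _; rewrite scalerA.
  rewrite (bigD1 i) //= eqxx scale1r big1 ?addr0 // => l' /negPf.
  by rewrite eq_sym => ->; rewrite scale0r.
have -> : (\sum_j a i j *: \sum_l e j l *: b1 l) - b1 i
    = - (\sum_j a i j *: (b2 j - \sum_l e j l *: b1 l))
      - (b1 i - \sum_j a i j *: b2 j).
  under [in RHS]eq_bigr do rewrite scalerBr.
  by rewrite sumrB !opprB addrA subrK.
apply: UB; last exact: ha.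
by rewrite -scaleN1r; apply: UZ; apply: Usum => j; apply: UZ.
Qed.

Lemma quot_dimE W m (b : 'I_m -> V) :
  quot_basis W U b -> quot_dim W U = m.
Proof.
move=> hb; have [|b' hb'] := epsilon_spec (inhabits 0%N)
  (fun m => exists b : 'I_m -> V, quot_basis W U b).
  by exists m, b.
by apply/eqP; rewrite eqn_leq (quot_basis_le hb' hb) (quot_basis_le hb hb').
Qed.

Lemma quot_basis_exists W (t : seq V) :
  (forall v, v \in t -> W v) ->
  (forall v, W v -> exists c : V -> K, v = \sum_(x <- t) c x *: x) ->
  exists m (b : 'I_m -> V), quot_basis W U b.
Proof.
move=> Wt St.
suff [m [b [Wb Sb Fb]]] : exists m (b : 'I_m -> V), [/\ forall i, W (b i),
      (forall v, v \in t -> exists c : 'I_m -> K, U (v - \sum_i c i *: b i))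
    & (forall c : 'I_m -> K, U (\sum_i c i *: b i) -> forall i, c i = 0)].
  exists m, b; split=> // v /St[c ->].
  elim: (t) Sb => [|x u IH] Sb.
    exists (fun=> 0); rewrite big_nil big1 ?subrr // => i _.
    by rewrite scale0r.
  have [|c1 h1] := IH; first by move=> y yu; apply: Sb; rewrite inE yu orbT.
  have [|c2 h2] := Sb x; first by rewrite inE eqxx.
  exists (fun i => c x * c2 i + c1 i); rewrite big_cons.
  under [X in _ - X]eq_bigr do rewrite scalerDl -scalerA.
  rewrite big_split /= -scaler_sumr opprD addrACA -scalerBr.
  by apply: UD => //; apply: UZ.
elim: t Wt {St} => [|x t IH] Wt.
  exists 0%N, (fun=> 0); split=> [[]//| //| c _ []//].
have [|m [b [Wb Sb Fb]]] := IH.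
  by move=> y yt; apply: Wt; rewrite inE yt orbT.
case: (classic (exists c : 'I_m -> K, U (x - \sum_i c i *: b i))) => [hx|hx].
  by exists m, b; split=> // v; rewrite inE => /orP[/eqP ->|/Sb].
exists m.+1, (fun i => oapp b x (unlift ord0 i)); split.
- move=> i; case: unliftP => [j _|_] /=; first exact: Wb.
  by apply: Wt; rewrite inE eqxx.
- move=> v; rewrite inE => /orP[/eqP ->|/Sb[c hc]].
    exists (fun i => (i == ord0)%:R).
    rewrite big_ord_recl eqxx unlift_none /= scale1r big1 ?addr0 ?subrr //.
    by move=> i _; rewrite scale0r.
  exists (fun i => oapp c 0 (unlift ord0 i)).
  rewrite big_ord_recl unlift_none /= scale0r add0r.
  by under eq_bigr do rewrite liftK.
- move=> c; rewrite big_ord_recl unlift_none /=.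
  under eq_bigr do rewrite liftK /=.
  move=> hc; have c0 : c ord0 = 0.
    apply/eqP/negP => /negP nz; apply: hx.
    exists (fun i => - ((c ord0)^-1 * c (lift ord0 i))).
    have := UZ (c ord0)^-1 hc; rewrite scalerDr scalerA mulVf // scale1r.
    rewrite scaler_sumr -sumrN; congr (U (_ + _)); apply: eq_bigr => i _.
    by rewrite scaleNr opprK scalerA.
  move: hc; rewrite c0 scale0r add0r => /Fb hc i.
  by case: (unliftP ord0 i) => [j ->|->].
Qed.

End Subspace.
End QuotientDimension.

Section HilbertSeries.
Variables (K : fieldType) (n : nat).
Implicit Types (I : {mpoly K[n]} -> Prop).

(* d-th coefficient of H(S/I, t) for I homogeneous:
   (S/I)_d = S_d / (S_d \cap I) *)
Definition hilbert_series I (d : nat) : nat :=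
  quot_dim (fun f : {mpoly K[n]} => f \is d.-homog) I.

Lemma hilbert_seriesP I d : is_ideal I ->
  exists b : 'I_(hilbert_series I d) -> {mpoly K[n]},
    quot_basis (fun f : {mpoly K[n]} => f \is d.-homog) I b.
Proof.
case=> I0 ID IM; have hU : is_subspace I.
  by split=> // a u v Iu Iv; apply: ID => //; rewrite -mul_mpolyC; apply: IM.
have [||m [b hb]] := quot_basis_exists hU (W := fun f => f \is d.-homog)
    (t := undup [seq 'X_[K, bmnm m] | m <- enum [set m : 'X_{1..n < d.+1} |
            mdeg m == d]]).
- move=> v; rewrite mem_undup => /mapP[m]; rewrite mem_enum inE => hm ->.
  by rewrite dhomogX.
- move=> v hv; pose X (m : 'X_{1..n < d.+1}) : {mpoly K[n]} := 'X_[m].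
  have injX : injective X.
    move=> m1 m2 /(congr1 (fun f => f@_m2)); rewrite !mcoeffX eqxx.
    by case: eqP => [/val_inj//|_] /eqP; rewrite eq_sym oner_eq0.
  exists (fun x => v@_(mlead x)).
  rewrite undup_id; last by rewrite map_inj_uniq ?enum_uniq.
  rewrite big_map big_enum_cond /=.
  have sv : (msize v <= d.+1)%N.
    rewrite msizeE; apply/bigmax_leqP_seq => m hm _.
    by have /= -> := dhomog_mf hv hm.
  rewrite [LHS](mpolywE (k := d.+1)) // [RHS]big_mkcond /=.
  apply: eq_bigr => m _; rewrite inE andbT mleadXm; case: ifP => // /negbT hm.
  by rewrite (dhomog_nemf_coeff hv hm) scale0r.
by rewrite /hilbert_series (quot_dimE hU hb); exists b.
Qed.

End HilbertSeries.

(* H = N / D in Z[[t]], for D with constant coefficient 1 (hence invertible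
   in Z[[t]]): the Cauchy product of H and D is N. *)
Definition series_eq_frac (H : nat -> nat) (N D : {poly int}) : Prop :=
  forall d : nat, \sum_(i < d.+1) (H i)%:Z * D`_(d - i) = N`_d.

Section CoverIdeal.
Variables (K : fieldType) (V : finType) (e : rel V).

Definition vertex_cover (w : {set V}) : bool :=
  [forall x, forall y, e x y ==> (x \in w) || (y \in w)].

Definition vertex_var (x : V) : {mpoly K[#|V|]} := 'X_(enum_rank x).

Definition cover_ideal : {mpoly K[#|V|]} -> Prop :=
  ideal_gen (fun f =>
    exists2 w, minset vertex_cover w & f = \prod_(x in w) vertex_var x).

End CoverIdeal.

Arguments vertex_var K {V} x.
Arguments cover_ideal K {V} e _.

Section Multipartite.
Variables (k : nat) (p : 'I_k -> nat).

Definition multipartite_vertex : finType := {i : 'I_k & 'I_(p i)}.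

Definition complete_multipartite : rel multipartite_vertex :=
  fun x y => tag x != tag y.

End Multipartite.

Arguments complete_multipartite {k} p x y.

(* Main.v *)
Require Import Defs.
From mathcomp Require Import all_boot all_order all_algebra.
From mathcomp Require Import mpoly ring zify.
From Stdlib Require Import Classical.

(* Localizing at an edge prime [(x, y)] makes every other variable a unit, so
   [J(G)^(s)] is the monomial ideal of the [x^a] with [a_x + a_y >= s] for each
   edge. For a complete multipartite graph only the minimum [mu_i] of [a] on
   each part matters, and the condition is [mu_i + mu_l >= s] for [i != l]. If
   some [mu_i = j < s/2], then [i] is the only such part and the condition says
   that [mu_l >= s - j] for [l != i]. Hence the indicator function of the
   complement is an integer combination of indicators of boxes [{a | a >= c}],
   and the series of such a box is [t^|c| / (1 - t)^n]. *)

Set Implicit Arguments.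
Unset Strict Implicit.
Unset Printing Implicit Defensive.

Import GRing.Theory.

Local Open Scope ring_scope.

(** * Powers of edge primes and their primary property *)

Lemma low_coef_eq0 (R : idomainType) (p q : {poly R}) (s : nat) :
  p`_0 != 0 -> (forall d, (d < s)%N -> (p * q)`_d = 0) ->
  forall d, (d < s)%N -> q`_d = 0.
Proof.
move=> p0 hpq; elim/ltn_ind => d IH ds; have := hpq d ds.
rewrite coefM big_ord_recl subn0 big1 ?addr0 => [/eqP|l _].
  by rewrite mulf_eq0 (negPf p0) => /eqP.
have e : (d - lift ord0 l < d)%N.
  by rewrite lift0 ltn_subrL (leq_ltn_trans _ (ltn_ord l)).
by rewrite (IH _ e (ltn_trans e ds)) mulr0.
Qed.

Section EdgePrime.
Variables (K : fieldType) (n : nat) (i j : 'I_n).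
Implicit Types (f g : {mpoly K[n]}) (m : 'X_{1..n}).

(** For [i != j] this is the power $(x_i, x_j)^s$, described through the support so that membership
    can be checked monomial by monomial. *)
Definition edge_power (s : nat) f : Prop :=
  forall m, m \in msupp f -> (s <= m i + m j)%N.

Lemma edge_power_ideal s : is_ideal (edge_power s).
Proof.
split=> [m | f g hf hg m /msuppD_le | f g hg m /msuppM_le].
- by rewrite mcoeff_msupp mcoeff0 eqxx.
- by rewrite mem_cat => /orP[/hf|/hg].
- case/allpairsP => -[m1 m2] /= [_ /hg h ->]; rewrite !mnmDE addnACA.
  exact: leq_trans h (leq_addl _ _).
Qed.

Lemma edge_powerM s t f g :
  edge_power s f -> edge_power t g -> edge_power (s + t) (f * g).
Proof.
move=> hf hg m /msuppM_le /allpairsP[[m1 m2] /= [/hf h1 /hg h2 ->]].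
by rewrite !mnmDE addnACA leq_add.
Qed.

Lemma edge_power_ideal_gen s A f :
  (forall g, A g -> edge_power s g) -> ideal_gen A f -> edge_power s f.
Proof.
move=> hA [q [a [g [hg ->]]]]; have [h0 hD hM] := edge_power_ideal s.
by apply: (big_ind (edge_power s)) => // l _; apply: hM; apply: hA.
Qed.

Lemma edge_power_exp (I : {mpoly K[n]} -> Prop) s f :
  (forall g, I g -> edge_power 1 g) -> ideal_exp I s f -> edge_power s f.
Proof.
move=> hI; apply: edge_power_ideal_gen => {f} _ [g [hg ->]].
elim: s g hg => [|s IH] g hg; first by rewrite big_ord0 => m.
rewrite big_ord_recl; apply: (@edge_powerM 1 s); first exact/hI/hg.
by apply: IH => l; apply: hg.
Qed.

(* [x_i -> x_i T] and [x_j -> x_j T]: then [edge_power s] is the preimage of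
   the ideal [(T^s)], and it is primary because [T] is prime. *)
Definition grade : {mpoly K[n]} -> {poly {mpoly K[n]}} :=
  mmap (polyC \o @mpolyC n K)
    (fun l => ('X_l)%:P * 'X^((l == i) + (l == j))).

(** A monomial [m] is sent to itself times $T^{m_i + m_j}$, so [grade] sorts the terms of [f] by
    $m_i + m_j$. *)
Lemma coef_grade f d m :
  (grade f)`_d@_m = if (m i + m j == d)%N then f@_m else 0.
Proof.
have w_sum (m' : 'X_{1..n}) : (\sum_l ((l == i) + (l == j)) * m' l = m' i + m' j)%N.
  under eq_bigr do rewrite mulnDl.
  rewrite big_split /=; congr addn.
    rewrite (bigD1 i) //= eqxx mul1n big1 ?addn0 // => l /negPf ->.
    by rewrite mul0n.
  rewrite (bigD1 j) //= eqxx mul1n big1 ?addn0 // => l /negPf ->.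
  by rewrite mul0n.
have -> : (grade f)`_d@_m =
    \sum_(m' <- msupp f) f@_m' * ((m' == m) && (m' i + m' j == d)%N)%:R.
  rewrite /grade /mmap coef_sum raddf_sum /=; apply: eq_bigr => m' _.
  rewrite /mmap1; under eq_bigr do rewrite exprMn -exprM -polyC_exp.
  rewrite big_split /= -rmorph_prod /= -mpolyXE_id prodrXr w_sum.
  rewrite mulrA -polyCM coefCM coefXn mul_mpolyC eq_sym.
  case: eqP => _; rewrite ?andbT ?andbF ?mulr1 ?mulr0 ?mcoeff0 //.
  by rewrite mcoeffZ mcoeffX.
rewrite {3}[f]mpolyE raddf_sum /=; case: ifP => [/eqP <-|h].
  apply: eq_bigr => m' _; rewrite mcoeffZ mcoeffX.
  by case: eqP => [->|]; rewrite ?eqxx.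
rewrite big1 // => m' _; case: eqP => [->|]; by rewrite ?h mulr0.
Qed.

Lemma edge_powerP s f :
  edge_power s f <-> (forall d, (d < s)%N -> (grade f)`_d = 0).
Proof.
split=> [hf d ds|h m].
  apply/mpolyP => m; rewrite coef_grade mcoeff0; case: eqP => // e.
  apply: memN_msupp_eq0; apply/negP => /hf; rewrite e.
  by rewrite leqNgt ds.
rewrite mcoeff_msupp; case: leqP => // /h /(congr1 (fun q => q@_m)).
by rewrite coef_grade eqxx mcoeff0 => ->; rewrite eqxx.
Qed.

Lemma gradeM f g : grade (f * g) = grade f * grade g.
Proof. exact: rmorphM. Qed.

(** The hypothesis on [g] says that [grade g] has a nonzero constant coefficient. Over a domain such
    a factor can be cancelled when the product vanishes modulo $T^s$. *)
Lemma edge_power_primary s f g :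
  edge_power s (g * f) -> ~ edge_power 1 g -> edge_power s f.
Proof.
move=> /edge_powerP hgf hg; apply/edge_powerP.
apply: (@low_coef_eq0 _ (grade g)); last by move=> d; rewrite -gradeM; apply: hgf.
by apply/eqP => h; apply/hg/edge_powerP => -[].
Qed.

Lemma edge_power_prime : prime_ideal (edge_power 1).
Proof.
split; first exact: edge_power_ideal.
  move=> /(_ 0%MM); rewrite !mnm0E mcoeff_msupp mcoeff1 eqxx oner_eq0.
  by move=> /(_ isT).
move=> f g h; case: (classic (edge_power 1 f)) => [|nf].
  by left.
by right; apply: edge_power_primary h nf.
Qed.

End EdgePrime.

(** * Generated ideals and their powers *)

Section IdealGen.
Variable R : comNzRingType.
Implicit Types (A I : R -> Prop) (f g : R).

Lemma ideal_gen_ideal A : is_ideal (ideal_gen A).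
Proof.
split.
- exists 0%N, (fun=> 0), (fun=> 0); split; first by case.
  by rewrite big_ord0.
- move=> f g [q [a [u [hu ->]]]] [q' [a' [u' [hu' ->]]]].
  exists (q + q')%N, (fun i => match split i with inl j => a j | inr j => a' j end),
    (fun i => match split i with inl j => u j | inr j => u' j end).
  split; first by move=> i; case: split.
  rewrite big_split_ord /=; congr (_ + _); apply: eq_bigr => i _.
    by rewrite (unsplitK (inl i)).
  by rewrite (unsplitK (inr i)).
- move=> f g [q [a [u [hu ->]]]].
  exists q, (fun i => f * a i), u; split=> //.
  by rewrite mulr_sumr; apply: eq_bigr => i _; rewrite mulrA.
Qed.

Lemma mem_ideal_gen A f : A f -> ideal_gen A f.
Proof.
by move=> Af; exists 1%N, (fun=> 1), (fun=> f); rewrite big_ord1 mul1r.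
Qed.

Lemma ideal_exp_mono2 I a b f g :
  I f -> I g -> ideal_exp I (a + b) (f ^+ a * g ^+ b).
Proof.
move=> If Ig; apply: mem_ideal_gen.
exists (fun i => if split i is inl _ then f else g).
split; first by move=> i; case: split.
rewrite big_split_ord /=; congr (_ * _).
  rewrite (eq_bigr (fun=> f)) ?prodr_const ?card_ord // => i _.
  by rewrite (unsplitK (inl i)).
rewrite (eq_bigr (fun=> g)) ?prodr_const ?card_ord // => i _.
by rewrite (unsplitK (inr i)).
Qed.

End IdealGen.

Lemma ideal_of_msupp (K : fieldType) n (I : {mpoly K[n]} -> Prop) f :
  is_ideal I -> (forall m, m \in msupp f -> I 'X_[m]) -> I f.
Proof.
case=> I0 ID IM h; rewrite [f]mpolyE big_seq; apply: (big_ind I) => // m hm.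
by rewrite -mul_mpolyC; apply/IM/h.
Qed.

(** * Symbolic powers of the cover ideal of a loopless graph *)

Section CoverIdealSymbolicPower.
Variables (K : fieldType) (V : finType) (e : rel V).
Hypothesis e_irr : irreflexive e.
Implicit Types (w : {set V}) (x y : V) (f g : {mpoly K[#|V|]}).

Local Notation J := (cover_ideal K e).
Local Notation edge_pow x y := (edge_power (enum_rank x) (enum_rank y)).

Let set_mnm w : 'X_{1..#|V|} := [multinom (enum_val i \in w : nat) | i < #|V|].

Let set_mnmE w x : set_mnm w (enum_rank x) = (x \in w).
Proof. by rewrite mnmE enum_rankK. Qed.

Lemma prod_vertex_var w :
  \prod_(x in w) vertex_var K x = 'X_[set_mnm w].
Proof.
rewrite /vertex_var mpolyXE_id [RHS](reindex enum_rank) /=; last first.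
  by apply: onW_bij; apply: enum_rank_bij.
rewrite big_mkcond; apply: eq_bigr => x _; rewrite set_mnmE.
by case: (x \in w).
Qed.

Lemma cover_ideal_cover w : vertex_cover e w -> J 'X_[set_mnm w].
Proof.
case/minset_exists => A hA /subsetP sA.
have [_ _ JM] := ideal_gen_ideal (fun f : {mpoly K[#|V|]} =>
    exists2 w, minset (vertex_cover e) w & f = \prod_(x in w) vertex_var K x).
rewrite -prod_vertex_var (bigID (mem A)) /= mulrC; apply: JM.
apply: mem_ideal_gen; exists A => //; apply: eq_bigl => x.
by case: (boolP (x \in A)) => [/sA ->|]; rewrite ?andbF.
Qed.

(** This is $J(G) = \bigcap (x, y)$ over the edges: the variables dividing a monomial form a vertex
    cover exactly when each edge contains one of them. *)
Lemma cover_idealP f :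
  J f <-> forall x y, e x y -> edge_pow x y 1 f.
Proof.
split=> [hf x y exy | h].
  apply: edge_power_ideal_gen hf => g [w /minsetp/forallP/(_ x)/forallP/(_ y)].
  rewrite exy /= => hw -> m; rewrite prod_vertex_var => /mem_msuppXP <-.
  by rewrite !set_mnmE; move: hw; do 2 case: (_ \in _).
have idJ : is_ideal J by exact: ideal_gen_ideal.
apply: ideal_of_msupp => // m hm; pose w := [set x | 0 < m (enum_rank x)]%N.
have /submK <- : (set_mnm w <= m)%MM.
  apply/mnm_lepP => i; rewrite -(enum_valK i) set_mnmE inE.
  by case: (m _).
rewrite mpolyXD; case: idJ => _ _; apply; apply: cover_ideal_cover.
apply/forallP => x; apply/forallP => y; apply/implyP => exy.
by rewrite !inE; have := h x y exy m hm; case: (m _).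
Qed.

Lemma edge_prime_associated x y :
  e x y -> associated_prime J (edge_pow x y 1).
Proof.
move=> exy; split; first exact: edge_power_prime.
(* The product of all variables other than [x] and [y] lies in the prime of every edge except the
   edge $\{x, y\}$ itself, so its class has that edge prime as annihilator. *)
exists 'X_[set_mnm (~: [set x; y])] => g; split=> [hg|/cover_idealP/(_ _ _ exy)].
  apply/cover_idealP => x' y' exy'.
  have [_ _ IM] := edge_power_ideal K (enum_rank x') (enum_rank y') 1.
  have [hin|hout] := boolP ((x' \in [set x; y]) && (y' \in [set x; y])).
    rewrite mulrC; apply: IM => m /hg.
    case/andP: hin; rewrite !inE.
    case/orP=> /eqP ? /orP[]/eqP ?; subst x' y'; rewrite ?e_irr // in exy' *.
    by rewrite addnC.
  apply: IM => m /mem_msuppXP <-; rewrite !set_mnmE !in_setC.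
  by move: hout; do 2 case: (_ \in _).
rewrite mulrC => /edge_power_primary; apply=> /(_ (set_mnm (~: [set x; y]))).
by rewrite msuppX mem_seq1 eqxx !set_mnmE !inE !eqxx orbT => /(_ isT).
Qed.

(** If [P] annihilates the class of [f0], then [f0] lies outside some edge prime, and the primary
    property forces [P] into it. Containment suffices: a denominator outside the edge prime is also
    outside [P]. *)
Lemma associated_prime_sub_edge P :
  associated_prime J P ->
  exists x y, e x y /\ forall f, P f -> edge_pow x y 1 f.
Proof.
case=> -[_ P1 _] [f0 hP].
have [x [y [exy hf0]]] : exists x y, e x y /\ ~ edge_pow x y 1 f0.
  apply: NNPP => hn; apply: P1; apply/hP; rewrite mul1r; apply/cover_idealP.
  by move=> x y exy; apply: NNPP => hf0; apply: hn; exists x, y.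
exists x, y; split=> // g /hP/cover_idealP/(_ _ _ exy) h.
by apply: edge_power_primary hf0; rewrite mulrC.
Qed.

(** Forward, $J^s$ lies in the $s$-th power of each edge prime, and that power is primary, so the
    denominator drops out. Backward, an explicit denominator carries [f] into $J^s$. *)
Lemma symbolic_power_cover_idealP s f :
  symbolic_power J s f <-> forall x y, e x y -> edge_pow x y s f.
Proof.
split=> [hf x y exy | hf P].
  have [g ng hg] := hf _ (edge_prime_associated exy).
  apply: edge_power_primary ng; apply: edge_power_exp hg => h /cover_idealP.
  exact.
case/associated_prime_sub_edge => x [y [exy hP]].
have nxy : x != y by apply: contraTneq exy => ->; rewrite e_irr.
(* The denominator is the $s$-th power of the product of all variables other than [x] and [y], a
   unit after localizing at the edge prime. *)
pose w := ~: [set x; y]; exists ('X_[set_mnm w] ^+ s).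
  move/hP; rewrite mpolyXn => /(_ (set_mnm w *+ s)%MM); rewrite msuppX mem_seq1.
  by rewrite eqxx !mulmnE !set_mnmE !inE !eqxx orbT => /(_ isT).
(* Without loops, the complement of a single vertex is a cover. *)
have cover z : J 'X_[set_mnm (~: [set z])].
  apply/cover_ideal_cover/forallP => a; apply/forallP => b; apply/implyP.
  by apply: contraTT; rewrite !inE negb_or !negbK => /andP[/eqP-> /eqP->]; rewrite e_irr.
have idJs : is_ideal (ideal_exp J s) by exact: ideal_gen_ideal.
have [Js0 JsD JsM] := idJs.
rewrite [f]mpolyE big_seq mulr_sumr; apply: (big_ind _ Js0 JsD) => m hm.
rewrite -mul_mpolyC mulrCA; apply: (JsM); have := hf x y exy m hm.
set mx := m _; set my := m _ => le_s.
(* Since $m_x + m_y \ge s$, one can split $s = b + c$ with $b \le m_x$ and $c \le m_y$. The covers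
   omitting $y$ and $x$, taken [b] and [c] times, multiply to $x^b y^c$ times the denominator. *)
pose b := minn mx s; pose c := (s - b)%N.
have b_le : (b <= mx)%N by rewrite geq_minl.
have c_le : (c <= my)%N
  by rewrite /c /b /minn; case: ltnP => _; rewrite ?subnn ?leq_subLR.
have s_bc : s = (b + c)%N by rewrite subnKC // geq_minr.
pose m' : 'X_{1..#|V|} :=
  [multinom (m i - b * (i == enum_rank x) - c * (i == enum_rank y))%N | i < #|V|].
have -> : 'X_[set_mnm w] ^+ s * 'X_[m] = 'X_[m'] * ('X_[set_mnm (~: [set y])] ^+ b
    * 'X_[set_mnm (~: [set x])] ^+ c) :> {mpoly K[#|V|]}.
  rewrite !mpolyXn -!mpolyXD; congr 'X_[_]; apply/mnmP => i.
  rewrite -(enum_valK i) !(mnmDE, mulmnE, set_mnmE) mnmE !(inj_eq enum_rank_inj) !inE.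
  case: (eqVneq _ x) => [->|_].
    by rewrite (negPf nxy) muln1 muln0 subn0 mul0n mul1n addn0 add0n subnK.
  case: (eqVneq _ y) => [->|_].
    by rewrite muln1 muln0 subn0 mul0n mul1n !add0n subnK.
  by rewrite !muln0 !subn0 !mul1n s_bc addnC.
by apply: JsM; rewrite s_bc; apply: ideal_exp_mono2.
Qed.

End CoverIdealSymbolicPower.

(** * Hilbert functions of monomial ideals *)

Lemma mcoeff_sumX (K : fieldType) n q (mu : 'I_q -> 'X_{1..n}) (c : 'I_q -> K) j :
  injective mu -> (\sum_i c i *: 'X_[mu i])@_(mu j) = c j.
Proof.
move=> mu_inj; rewrite raddf_sum (bigD1 j) //= mcoeffZ mcoeffX eqxx mulr1.
rewrite big1 ?addr0 // => i /negPf ij.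
by rewrite mcoeffZ mcoeffX (inj_eq mu_inj) ij mulr0.
Qed.

Section MonomialIdealHilbert.
Variables (K : fieldType) (n : nat) (I : {mpoly K[n]} -> Prop).
Variable Q : pred 'X_{1..n}.
Hypothesis IQ : forall f, I f <-> forall m, m \in msupp f -> Q m.

(** Bounding the exponents by [N] gives a finite type, over which monomials can be counted and
    summed. *)
Definition mnm_ffun N (f : {ffun 'I_n -> 'I_N}) : 'X_{1..n} :=
  [multinom f i : nat | i < n].

Lemma mnm_ffun_inj N : injective (@mnm_ffun N).
Proof.
move=> f g /mnmP fg; apply/ffunP => i; apply: val_inj.
by have := fg i; rewrite !mnmE.
Qed.

Lemma monomial_ideal_subspace : is_subspace I.
Proof.
split; first by apply/IQ => m; rewrite mcoeff_msupp mcoeff0 eqxx.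
move=> a u v /IQ Iu /IQ Iv; apply/IQ => m /msuppD_le.
by rewrite mem_cat => /orP[/msuppZ_le/Iu|/Iv].
Qed.

(** The monomials of degree [d] outside [I] are a basis of $(S/I)_d$. The bound [N] is left free so
    that one finite type serves several degrees. *)
Lemma hilbert_series_monomial N d : (d < N)%N ->
  hilbert_series I d =
  #|[set f : {ffun 'I_n -> 'I_N} |
      (mdeg (mnm_ffun f) == d) && ~~ Q (mnm_ffun f)]|.
Proof.
move=> dN; set A := [set f | _]; pose mu (i : 'I_#|A|) := mnm_ffun (enum_val i).
have mu_inj : injective mu by move=> i j /mnm_ffun_inj/enum_val_inj.
have muA i : (mdeg (mu i) == d) /\ ~~ Q (mu i).
  by have := enum_valP i; rewrite inE => /andP.
have muP m : mdeg m = d -> ~~ Q m -> exists i, m = mu i.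
  move=> hd hQ; have mN i : (m i < N)%N.
    apply: leq_ltn_trans dN; rewrite -hd mdegE (bigD1 i) //=; exact: leq_addr.
  pose f := [ffun i => Ordinal (mN i)].
  have fm : mnm_ffun f = m by apply/mnmP => i; rewrite mnmE ffunE.
  have fA : f \in A by rewrite inE fm hd eqxx.
  by exists (enum_rank_in fA f); rewrite /mu enum_rankK_in.
apply: (quot_dimE monomial_ideal_subspace (b := fun i => 'X_[mu i])); split.
- by move=> i; have [h _] := muA i; rewrite dhomogX.
- move=> v hv; exists (fun i => v@_(mu i)); apply/IQ => m.
  rewrite mcoeff_msupp mcoeffB; apply: contraR => nQ.
  have [/muP/(_ nQ)[i ->]|md] := eqVneq (mdeg m) d.
    by rewrite mcoeff_sumX // subrr.
  rewrite (dhomog_nemf_coeff hv) // sub0r oppr_eq0 raddf_sum big1 //= => i _.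
  rewrite mcoeffZ mcoeffX; case: eqP => [e|]; last by rewrite mulr0.
  by have [] := muA i; rewrite e (negPf md).
- move=> c /IQ h i; have [_ nQ] := muA i; apply/eqP; apply: contraR nQ => ci.
  by apply: h; rewrite mcoeff_msupp mcoeff_sumX.
Qed.

End MonomialIdealHilbert.

(** * Generating functions of boxes of monomials *)

(* Truncating exponents below [N] turns the generating function of an upward
   closed box of monomials into a product of polynomials, exact modulo [X^N]. *)
Section GeneratingFunction.
Variables (n N : nat).
Local Notation F := {ffun 'I_n -> 'I_N}.

(** The coefficient of $X^d$ in $(1 - X)^n \sum_f \chi(f) X^{|f|}$. Being linear in [chi], it turns
    identities between indicators into identities between numerators. *)
Definition gen_coef (d : nat) (chi : F -> int) : int :=
  \sum_f chi f * ('X^(\sum_i f i) * (1 - 'X) ^+ n : {poly int})`_d.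

Lemma eq_gen_coef d chi1 chi2 : chi1 =1 chi2 -> gen_coef d chi1 = gen_coef d chi2.
Proof. by move=> h; apply: eq_bigr => f _; rewrite h. Qed.

Lemma gen_coefD d chi1 chi2 :
  gen_coef d (fun f => chi1 f + chi2 f) = gen_coef d chi1 + gen_coef d chi2.
Proof. by rewrite -big_split; apply: eq_bigr => f _; rewrite mulrDl. Qed.

Lemma gen_coefB d chi1 chi2 :
  gen_coef d (fun f => chi1 f - chi2 f) = gen_coef d chi1 - gen_coef d chi2.
Proof. by rewrite -sumrB; apply: eq_bigr => f _; rewrite mulrBl. Qed.

Lemma gen_coefZ d a chi :
  gen_coef d (fun f => a * chi f) = a * gen_coef d chi.
Proof. by rewrite mulr_sumr; apply: eq_bigr => f _; rewrite mulrA. Qed.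

Lemma gen_coef_sum d (T : Type) (r : seq T) (chi : T -> F -> int) :
  gen_coef d (fun f => \sum_(t <- r) chi t f) = \sum_(t <- r) gen_coef d (chi t).
Proof. by rewrite exchange_big; apply: eq_bigr => f _; rewrite mulr_suml. Qed.

Lemma geometric_box (a : nat) :
  (\sum_(j < N) (a <= j)%N%:R * 'X^j) * (1 - 'X) =
  'X^a - 'X^(maxn a N) :> {poly int}.
Proof.
elim: N => [|M IH]; first by rewrite big_ord0 mul0r maxn0 subrr.
rewrite big_ord_recr /= mulrDl {}IH.
have [aM|Ma] := leqP a M.
  rewrite (maxn_idPr (leqW aM)) mul1r mulrBr mulr1 -exprSr.
  by rewrite addrA subrK.
by rewrite mul0r mul0r addr0 (maxn_idPl Ma).
Qed.

(** The sum over the box factors by coordinates, and each factor $1 - X$ telescopes one geometric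
    sum. *)
Lemma gen_coef_box d (a : 'I_n -> nat) : (d < N)%N ->
  gen_coef d (fun f => [forall i, a i <= f i]%N%:R) = ('X^(\sum_i a i))`_d.
Proof.
move=> dN; have -> : gen_coef d (fun f => [forall i, a i <= f i]%N%:R) =
    (\prod_i ('X^(a i) - 'X^(maxn (a i) N)))`_d.
  under [in RHS]eq_bigr do rewrite -geometric_box.
  rewrite big_split /= prodr_const card_ord bigA_distr_bigA mulr_suml coef_sum.
  apply: eq_bigr => f _; rewrite big_split /= prodrXr -mulrA.
  have -> : \prod_i (a i <= f i)%N%:R = [forall i, a i <= f i]%N%:R%:P :> {poly int}.
    case: forallP => [h|h]; first by rewrite big1 // => i _; rewrite h.
    by have [i hi] : exists i, ~~ (a i <= f i)%N;
      [apply/existsP; rewrite -negb_forall; apply/forallP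
      | rewrite (bigD1 i) //= (negPf hi) mul0r].
  by rewrite coefCM.
(* Every truncation term $X^{\max(a_i, N)}$ is divisible by $X^N$, hence invisible in degree $d <
   N$. *)
have [q ->] : exists q, \prod_i ('X^(a i) - 'X^(maxn (a i) N)) =
    'X^(\sum_i a i) + q * 'X^N :> {poly int}.
  rewrite -prodrXr; apply: (big_ind2 (fun u v => exists q, u = v + q * 'X^N)).
  - by exists 0; rewrite mul0r addr0.
  - move=> u1 v1 u2 v2 [q1 ->] [q2 ->].
    exists (v1 * q2 + q1 * v2 + q1 * q2 * 'X^N).
    by ring.
  - move=> i _; exists (- 'X^(maxn (a i) N - N)).
    by rewrite mulNr -exprD subnK ?leq_maxr.
by rewrite coefD coefMXn dN addr0.
Qed.

End GeneratingFunction.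

(** Exponents in degree at most [d] are below [d.+1], so this truncation loses nothing in the first
    [d.+1] terms of the Cauchy product. *)
Lemma hilbert_series_gen_coef (K : fieldType) n (I : {mpoly K[n]} -> Prop)
    (Q : pred 'X_{1..n}) d :
  (forall f, I f <-> forall m, m \in msupp f -> Q m) ->
  \sum_(i < d.+1) (hilbert_series I i)%:Z * ((1 - 'X) ^+ n : {poly int})`_(d - i) =
  gen_coef (N := d.+1) d (fun f => (~~ Q (mnm_ffun f))%:R).
Proof.
move=> IQ; pose D : {poly int} := (1 - 'X) ^+ n.
transitivity (\sum_(i < d.+1) \sum_(f : {ffun 'I_n -> 'I_d.+1})
    (~~ Q (mnm_ffun f))%:R * (((\sum_l f l)%N == i)%:R * D`_(d - i))).
  apply: eq_bigr => i _; rewrite (hilbert_series_monomial IQ (ltn_ord i)).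
  rewrite -sum1_card -[Posz _]natz natr_sum mulr_suml [LHS]big_mkcond /=.
  apply: eq_bigr => f _; rewrite inE mdegE.
  under eq_bigr do rewrite mnmE.
  by case: eqP => _; case: (Q _) => /=; rewrite ?(mul1r, mul0r, mulr0).
rewrite exchange_big; apply: eq_bigr => f _; rewrite -mulr_sumr; congr (_ * _).
rewrite coefXnM; case: ltnP => [df|fd].
  by rewrite big1 // => i _; rewrite gtn_eqF ?mul0r // (leq_trans (ltn_ord i)).
move: (\sum_i f i)%N fd => w wd.
rewrite (bigD1 (Ordinal (wd : (w < d.+1)%N))) //= eqxx mul1r big1 ?addr0 // => i.
by rewrite -val_eqE /= eq_sym => /negPf ->; rewrite mul0r.
Qed.

(** * Indicator identities in the part minima *)

Section PartMinima.
Variables (k : nat) (mu : 'I_k -> nat).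

Definition above (c : 'I_k -> nat) : bool := [forall i, (c i <= mu i)%N].

Definition at_part (i : 'I_k) (b c : nat) (l : 'I_k) : nat := if l == i then b else c.

Definition pairwise_sum_ge (s : nat) : bool :=
  [forall i, forall l, (i != l) ==> (s <= mu i + mu l)%N].

Lemma pairwise_sum_geP s :
  reflect (forall i l, i != l -> s <= mu i + mu l)%N (pairwise_sum_ge s).
Proof.
by apply: (iffP 'forall_forallP) => h i l; [move/(implyP (h i l))|apply/implyP/h].
Qed.

Lemma above_at_part i b c :
  above (at_part i b c) = (b <= mu i)%N && [forall (l | l != i), (c <= mu l)%N].
Proof.
apply/forallP/andP => [h|[hb /forall_inP hc] l].
  have := h i; rewrite /at_part eqxx; split=> //; apply/forall_inP => l li.
  by have := h l; rewrite /at_part (negPf li).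
by rewrite /at_part; case: eqVneq => [->|/hc].
Qed.

Lemma above_at_part_succ i b c :
  (above (at_part i b c))%:R - (above (at_part i b.+1 c))%:R =
  ((mu i == b) && [forall (l | l != i), (c <= mu l)%N])%:R :> int.
Proof. by rewrite !above_at_part; case: forall_inP => _; case: ltngtP. Qed.

(** Up to sign, the summand indicates that $\mu_i = j$ and that all other minima are at least $s -
    j$. When some $\mu_{i_0} < r$, only the term with $i = i_0$ and $j = \mu_{i_0}$ can survive, and
    it encodes the pairwise condition. *)
Lemma sum_above_at_part r s : (r.*2 <= s)%N ->
  \sum_(0 <= j < r) \sum_(i < k) ((above (at_part i j.+1 (s - j)))%:R
    - (above (at_part i j (s - j)))%:R) =
  - (pairwise_sum_ge s && ~~ above (fun=> r))%:R :> int.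
Proof.
move=> rs; rewrite -[LHS]opprK -sumrN; congr (- _).
under eq_bigr do rewrite -sumrN; under eq_bigr do under eq_bigr do rewrite opprB.
under eq_bigr do under eq_bigr do rewrite above_at_part_succ.
rewrite big_mkord; have [/forallP hr|/forallPn[i0]] := boolP (above _).
  rewrite andbF big1 // => j _; rewrite big1 // => i _.
  by rewrite gtn_eqF // (leq_trans (ltn_ord j)).
rewrite -ltnNge andbT => i0r; rewrite exchange_big (bigD1 i0) //=.
(* A surviving term with $i \ne i_0$ would need $\mu_{i_0} \ge s - j > r$. *)
rewrite [X in _ + X]big1 ?addr0 => [|i ii0]; last first.
  rewrite big1 // => j _; case: forall_inP => [/(_ i0)|]; rewrite ?andbF //.
  by rewrite eq_sym => /(_ ii0); have := ltn_ord j; lia.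
rewrite (bigD1 (Ordinal i0r)) //= eqxx big1 ?addr0 => [|j]; last first.
  by rewrite -val_eqE eq_sym => /negPf ->.
(* Pairs avoiding $i_0$ are automatic: both minima are at least $s - \mu_{i_0}$, which exceeds
   $s/2$. *)
congr (nat_of_bool _)%:R; apply/forall_inP/pairwise_sum_geP => [h i l il|h l li0].
  case: (eqVneq i i0) il => [->|ii0] il.
    by have := h l; rewrite eq_sym => /(_ il); lia.
  case: (eqVneq l i0) il => [->|li0] il.
    by have := h i ii0; lia.
  by have := h l li0; have := h i ii0; lia.
by have := h l i0 li0; lia.
Qed.

(** If all minima are at least $r$, the pairwise condition holds; the remaining case is the double
    sum. *)
Lemma indicator_even r s : s = (2 * r)%N ->
  (~~ pairwise_sum_ge s)%:R = 1 - (above (fun=> r))%:R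
    + \sum_(0 <= j < r) \sum_(i < k) ((above (at_part i j.+1 (s - j)))%:R
      - (above (at_part i j (s - j)))%:R) :> int.
Proof.
move=> sr; rewrite sum_above_at_part; last lia.
have : above (fun=> r) -> pairwise_sum_ge s.
  by move/forallP => h; apply/pairwise_sum_geP => i l _; have := h i; have := h l; lia.
by case: above => [->|] //; case: pairwise_sum_ge.
Qed.

(** When all minima are at least $r$, the pairwise condition allows at most one of them to equal
    $r$. This is a union of $k$ boxes, any two of which meet exactly in the box at $r + 1$; that box
    is counted $k$ times, hence the correction by $k - 1$. *)
Lemma indicator_odd r s : (0 < k)%N -> s = (2 * r + 1)%N ->
  (~~ pairwise_sum_ge s)%:R = 1 + (k - 1)%N%:R * (above (fun=> r.+1))%:R
    - \sum_(i < k) (above (at_part i r r.+1))%:R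
    + \sum_(0 <= j < r) \sum_(i < k) ((above (at_part i j.+1 (s - j)))%:R
      - (above (at_part i j (s - j)))%:R) :> int.
Proof.
move=> k0 sr; rewrite sum_above_at_part; last lia.
have -> : \sum_(i < k) (above (at_part i r r.+1))%:R =
   (k - 1)%N%:R * (above (fun=> r.+1))%:R
    + (pairwise_sum_ge s && above (fun=> r))%:R :> int.
  have [/forallP h1|/forallPn[i0]] := boolP (above (fun=> r.+1)).
    have -> : pairwise_sum_ge s.
      by apply/pairwise_sum_geP => i l _; have := h1 i; have := h1 l; lia.
    have -> : above (fun=> r) by apply/forallP => i; apply: ltnW.
    rewrite (eq_bigr (fun=> 1)) => [|i _].
      by rewrite sumr_const card_ord mulr1 -natrD subnK.
    rewrite above_at_part ltnW //=; case: forall_inP => // -[] l _; exact: h1.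
  (* Now $\mu_{i_0} \le r$, so only the box of $i_0$ can contain the point. *)
  rewrite -leqNgt mulr0 add0r => i0r.
  rewrite (bigD1 i0) //= big1 ?addr0 => [|i ii0]; last first.
    rewrite above_at_part; case: forall_inP => [/(_ i0)|]; rewrite ?andbF //.
    by rewrite eq_sym => /(_ ii0); lia.
  congr (nat_of_bool _)%:R; rewrite above_at_part.
  apply/andP/andP => -[].
    move=> h0 /forall_inP h; split.
      apply/pairwise_sum_geP => i l il.
      case: (eqVneq i i0) il => [->|ii0] il.
        by have := h l; rewrite eq_sym => /(_ il); lia.
      case: (eqVneq l i0) il => [->|li0] il.
        by have := h i ii0; lia.
      by have := h l li0; have := h i ii0; lia.
    by apply/forallP => i; case: (eqVneq i i0) => [->//|/h/ltnW].
  move/pairwise_sum_geP => h /forallP hr; split; first exact: hr.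
  by apply/forall_inP => l /h; lia.
by case: (above (fun=> r)); case: pairwise_sum_ge; rewrite /=; ring.
Qed.

End PartMinima.

(** * Complete multipartite graphs: from exponents to part minima *)

Section MultipartiteGenCoef.
Variables (k : nat) (p : 'I_k -> nat).
Hypothesis p_gt0 : forall i, (0 < p i)%N.
Local Notation V := (multipartite_vertex p).
Local Notation n := (\sum_(i < k) p i)%N.

Definition on_parts (c : 'I_k -> nat) (l : 'I_#|V|) : nat := c (tag (enum_val l)).

Lemma card_multipartite_vertex : #|V| = n.
Proof.
by rewrite card_tagged sumnE big_map big_enum; apply: eq_bigr => i _; rewrite card_ord.
Qed.

Lemma sum_on_parts c : (\sum_l on_parts c l = \sum_(i < k) p i * c i)%N.
Proof.
rewrite (reindex enum_rank) /=; last by apply: onW_bij; apply: enum_rank_bij.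
transitivity (\sum_(i < k) \sum_(j < p i) c i)%N; last first.
  by apply: eq_bigr => i _; rewrite sum_nat_const card_ord.
rewrite (sig_big_dep predT (fun=> predT) (fun i _ => c i)) /=.
by apply: eq_bigr => x _; rewrite /on_parts enum_rankK.
Qed.

Lemma sum_on_parts_at_part i b c :
  (\sum_(l < k) p l * at_part i b c l = p i * b + (n - p i) * c)%N.
Proof.
rewrite (bigD1 i) //= [in RHS](bigD1 i) //= addKn big_distrl /= /at_part eqxx.
by congr addn; apply: eq_bigr => l /negPf ->.
Qed.

(** Parts are nonempty, so minima are attained. Vertices of distinct parts are always adjacent, so
    the edge conditions between two parts reduce to the one at their minimizers. *)
Lemma part_minima N (f : {ffun 'I_#|V| -> 'I_N}) :
  exists mu : 'I_k -> nat,
    (forall c, [forall l, on_parts c l <= f l]%N = above mu c)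
    /\ forall s, [forall x : V, forall y : V, complete_multipartite p x y ==>
         (s <= f (enum_rank x) + f (enum_rank y))%N] = pairwise_sum_ge mu s.
Proof.
pose g i (j : 'I_(p i)) : nat := f (enum_rank (Tagged (fun i => 'I_(p i)) j : V)).
have /fin_all_exists[arg hg] i : exists j0 : 'I_(p i), forall j, (g i j0 <= g i j)%N.
  case: (@arg_minnP _ (Ordinal (p_gt0 i)) xpredT (g i)) => // j0 _ h.
  by exists j0 => j; apply: h.
exists (fun i => g i (arg i)); split=> [c|s].
  apply/forallP/forallP => h.
    move=> i; have := h (enum_rank (Tagged _ (arg i) : V)).
    by rewrite /on_parts enum_rankK.
  move=> l; rewrite -(enum_valK l) /on_parts enum_rankK; case: (enum_val l) => i j /=.
  exact: leq_trans (h i) (hg i j).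
apply/'forall_forallP/pairwise_sum_geP => h.
  by move=> i l il; have /implyP := h (Tagged _ (arg i)) (Tagged _ (arg l)); apply.
move=> [i j] [i' j']; apply/implyP => ii'; apply: leq_trans (h i i' ii') _.
exact: leq_add (hg i j) (hg i' j').
Qed.

Lemma gen_coef_above d c :
  gen_coef (N := d.+1) d (fun f : {ffun 'I_#|V| -> 'I_d.+1} =>
    [forall l, on_parts c l <= f l]%N%:R) = ('X^(\sum_(i < k) p i * c i))`_d.
Proof. by rewrite gen_coef_box // sum_on_parts. Qed.

End MultipartiteGenCoef.

(** * Hilbert series of the symbolic powers, even and odd *)

Section MultipartiteHilbert.
Variables (K : fieldType) (k : nat) (p : 'I_k -> nat).
Hypothesis p_gt0 : forall i, (0 < p i)%N.
Local Notation V := (multipartite_vertex p).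
Local Notation n := (\sum_(i < k) p i)%N.
Local Notation J := (cover_ideal K (complete_multipartite p)).

Let box N c (f : {ffun 'I_#|V| -> 'I_N}) : int := [forall l, on_parts c l <= f l]%N%:R.

(** Splits the computation in two: an indicator identity in the part minima, and the generating
    function of its right-hand side. *)
Lemma series_eq_frac_symbolic_power s (Num : {poly int})
    (chi : forall N, {ffun 'I_#|V| -> 'I_N} -> int) :
  (forall N f (mu : 'I_k -> nat), (forall c, box c f = (above mu c)%:R) ->
    (~~ pairwise_sum_ge mu s)%:R = chi N f) ->
  (forall d, gen_coef (N := d.+1) d (@chi d.+1) = Num`_d) ->
  series_eq_frac (hilbert_series (symbolic_power J s)) Num ((1 - 'X) ^+ n).
Proof.
move=> hchi hNum d; pose Q (m : 'X_{1..#|V|}) := [forall x : V, forall y : V,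
  complete_multipartite p x y ==> (s <= m (enum_rank x) + m (enum_rank y))%N].
have IQ f : symbolic_power J s f <-> forall m, m \in msupp f -> Q m.
  have irr : irreflexive (complete_multipartite p).
    by move=> x; rewrite /complete_multipartite eqxx.
  split=> [/(symbolic_power_cover_idealP irr) h m hm|h].
    by apply/'forall_forallP => x y; apply/implyP => exy; apply: h.
  apply/(symbolic_power_cover_idealP irr) => x y exy m /h.
  by move/'forall_forallP/(_ x y)/implyP; apply.
rewrite -(card_multipartite_vertex p) (hilbert_series_gen_coef d IQ) -hNum.
apply: eq_gen_coef => f; have [mu [hbox hpair]] := part_minima p_gt0 f.
rewrite -(hchi _ f mu) => [|c]; last by rewrite /box hbox.
rewrite -hpair; congr (~~ _)%:R; apply: eq_forallb => x; apply: eq_forallb => y.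
by rewrite !mnmE.
Qed.

Let steps r s N (f : {ffun 'I_#|V| -> 'I_N}) : int :=
  \sum_(0 <= j < r) \sum_(i < k)
    (box (at_part i j.+1 (s - j)) f - box (at_part i j (s - j)) f).

(** Raising the threshold on part $i$ from $j$ to $j + 1$ multiplies the box monomial by $X^{p_i}$,
    whence the factor $X^{p_i} - 1$. *)
Lemma gen_coef_steps r s d :
  gen_coef (N := d.+1) d (@steps r s d.+1) =
  (\sum_(0 <= j < r) \sum_(i < k)
      ('X^(p i) - 1) * 'X^((s - j) * (n - p i) + j * p i))`_d.
Proof.
rewrite gen_coef_sum coef_sum; apply: eq_bigr => j _.
rewrite gen_coef_sum coef_sum; apply: eq_bigr => i _.
rewrite gen_coefB !gen_coef_above !sum_on_parts_at_part -coefB mulrBl mul1r -exprD.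
by congr (('X^_ - 'X^_)`_d); lia.
Qed.

Let gen_coef_box1 d :
  gen_coef (N := d.+1) d (fun f : {ffun 'I_#|V| -> 'I_d.+1} => 1) = (1 : {poly int})`_d.
Proof.
(* The constant 1 is the indicator of the box with all thresholds 0. *)
have -> : 1 = 'X^(\sum_(i < k) p i * 0) :> {poly int}.
  by rewrite big1 ?expr0 // => i _; rewrite muln0.
rewrite -gen_coef_above; apply: eq_gen_coef => f.
by case: forallP => // -[].
Qed.

Let sum_const r : (\sum_(i < k) p i * r = r * n)%N.
Proof. by rewrite -big_distrl mulnC. Qed.

Lemma hilbert_series_symbolic_even r s : s = (2 * r)%N ->
  series_eq_frac (hilbert_series (symbolic_power J s))
    (1 - 'X^(r * n)
     + \sum_(0 <= j < r) \sum_(i < k)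
         ('X^(p i) - 1) * 'X^((s - j) * (n - p i) + j * p i))
    ((1 - 'X) ^+ n).
Proof.
move=> sr; apply: (@series_eq_frac_symbolic_power s _
  (fun N f => 1 - box (fun=> r) f + steps r s f)) => [N f mu hbox|d].
  rewrite (indicator_even mu sr) hbox; congr (_ + _); apply: eq_bigr => j _.
  by apply: eq_bigr => i _; rewrite !hbox.
rewrite gen_coefD gen_coefB gen_coef_steps gen_coef_box1 gen_coef_above sum_const.
by rewrite coefD coefB.
Qed.

Lemma hilbert_series_symbolic_odd r s : (0 < k)%N -> s = (2 * r + 1)%N ->
  series_eq_frac (hilbert_series (symbolic_power J s))
    (1 + (k - 1)%N%:R * 'X^((r + 1) * n)
     - \sum_(i < k) 'X^((n - p i) + r * n)
     + \sum_(0 <= j < r) \sum_(i < k)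
         ('X^(p i) - 1) * 'X^((s - j) * (n - p i) + j * p i))
    ((1 - 'X) ^+ n).
Proof.
move=> k0 sr; apply: (@series_eq_frac_symbolic_power s _
  (fun N f => 1 + (k - 1)%N%:R * box (fun=> r.+1) f
     - \sum_(i < k) box (at_part i r r.+1) f + steps r s f)) => [N f mu hbox|d].
  rewrite (indicator_odd mu k0 sr) hbox; congr (_ - _ + _).
    by apply: eq_bigr => i _; rewrite hbox.
  by apply: eq_bigr => j _; apply: eq_bigr => i _; rewrite !hbox.
rewrite gen_coefD gen_coefB gen_coefD gen_coefZ gen_coef_steps gen_coef_box1.
rewrite gen_coef_above sum_const gen_coef_sum addn1.
rewrite coefD coefB coefD -polyC_natr coefCM.
congr (_ - _ + _); rewrite coef_sum; apply: eq_bigr => i _.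
rewrite gen_coef_above sum_on_parts_at_part; congr (('X^_)`_d).
(* The exponents $p_i r + (n - p_i)(r + 1)$ and $(n - p_i) + rn$ agree once the truncated
   subtraction is known to be exact. *)
have : (p i <= n)%N by rewrite (bigD1 i) //= leq_addr.
by move: n => n'; nia.
Qed.

End MultipartiteHilbert.

Theorem theorem4p10 (K : fieldType) (k : nat) (p : 'I_k -> nat) (n : nat)
  (hk : (2 <= k)%N)
  (hp : forall i j : 'I_k, (i <= j)%N -> (p j <= p i)%N)
  (hp1 : forall i : 'I_k, (1 <= p i)%N)
  (hn : n = (\sum_(i < k) p i)%N) :
  let J := cover_ideal K (complete_multipartite p) in
  (forall r s : nat, (1 <= r)%N -> s = (2 * r)%N ->
     series_eq_frac (hilbert_series (symbolic_power J s))
       (1 - 'X^(r * n)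
        + \sum_(0 <= j < r) \sum_(i < k)
            ('X^(p i) - 1) * 'X^((s - j) * (n - p i) + j * p i))
       ((1 - 'X) ^+ n))
  /\
  (forall r s : nat, s = (2 * r + 1)%N ->
     series_eq_frac (hilbert_series (symbolic_power J s))
       (1 + (k - 1)%N%:R * 'X^((r + 1) * n)
        - \sum_(i < k) 'X^((n - p i) + r * n)
        + \sum_(0 <= j < r) \sum_(i < k)
            ('X^(p i) - 1) * 'X^((s - j) * (n - p i) + j * p i))
       ((1 - 'X) ^+ n)).
Proof.
move=> J; rewrite {n}hn; split=> [r s _|r s].
  exact: hilbert_series_symbolic_even.
by apply: hilbert_series_symbolic_odd => //; apply: ltnW.
Qed.
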